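(* Let $\vec G=(V,E)$ be a directed tree graph with vertex set $V=\{1,\dots,n\}$ and $n-1$ edges, and let $D\in\mathbb{R}^{(n-1)\times n}$ be its incidence matrix. Let $A=(1,0,\dots,0)\in\mathbb{R}^{1\times n}$ and let $$X=\begin{bmatrix}A\\ D\end{bmatrix}^{-1}\in\mathbb{R}^{n\times n},$$ the path matrix of the tree graph rooted at vertex $1$. Then for every $Y\in\mathbb{R}^n$ and every $\lambda>0$, $$\hat f_{\mathrm A}:=\arg\min_{f\in\mathbb{R}^n}\left\{\|Y-f\|_n^2+2\lambda\|Df\|_1\right\}=X\arg\min_{\beta\in\mathbb{R}^n}\left\{\|Y-X\beta\|_n^2+2\lambda\|\beta_{-1}\|_1\right\}.$$
   Context: For $v\in\mathbb{R}^n$, $\|v\|_n^2=\|v\|_2^2/n$. $\beta_{-1}$ is the vector $\beta$ with its first entry removed. A tree graph is a connected graph (connectedness and cycles being understood disregarding edge directions) with no cycles. For a directed graph with edges $e_1,\dots,e_m$, where $e_i=(e_i^-,e_i^+)$ is directed from vertex $e_i^-$ to vertex $e_i^+$, the incidence matrix $D\in\{-1,0,1\}^{m\times n}$ has entries $D_{ij}=-1$ if $j=e_i^-$, $D_{ij}=+1$ if $j=e_i^+$, and $D_{ij}=0$ otherwise. ''Path matrix rooted at vertex $1$'' is only a name for the inverse matrix $X$ defined in the claim. *)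

(* Defs.v *)
From mathcomp Require Import all_boot all_order all_algebra.
From mathcomp Require Import boolp classical_sets reals.

Set Implicit Arguments.
Unset Strict Implicit.
Unset Printing Implicit Defensive.

Import Order.TTheory GRing.Theory Num.Theory.
Local Open Scope ring_scope.
Local Open Scope classical_set_scope.

(* A directed (multi)graph with m edges on the vertices {0, ..., n-1} is
   the map sending the index i of an edge to the pair (e_i^-, e_i^+). *)
Definition digraph (m n : nat) : Type := 'I_m -> 'I_n * 'I_n.

Section Digraph.
Variables (m n : nat) (e : digraph m n).

Definition undirected_adj : rel 'I_n :=
  fun x y => [exists i, (e i == (x, y)) || (e i == (y, x))].

Definition graph_connected : Prop := forall x y, connect undirected_adj x y.

(* A dart (i, b) is the edge e_i, traversed forwards if b = false and
   backwards if b = true. *)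
Definition dart_source (d : 'I_m * bool) : 'I_n :=
  if d.2 then (e d.1).2 else (e d.1).1.

Definition dart_target (d : 'I_m * bool) : 'I_n :=
  if d.2 then (e d.1).1 else (e d.1).2.

(* Edges and visited vertices are pairwise distinct, so self-loops and pairs of
   parallel or antiparallel edges are cycles (of length 1 and 2), whereas going
   back and forth along a single edge is not. *)
Definition graph_cycle (c : seq ('I_m * bool)) : Prop :=
  [/\ c != [::],
      cycle (fun d d' => dart_target d == dart_source d') c,
      uniq [seq d.1 | d <- c]
    & uniq [seq dart_source d | d <- c]].

Definition tree_graph : Prop :=
  graph_connected /\ forall c, ~ graph_cycle c.

Definition incidence (R : realType) : 'M[R]_(m, n) :=
  \matrix_(i, j) (if j == (e i).1 then -1 else if j == (e i).2 then 1 else 0).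

End Digraph.

(* Here 1 + m is convertible to m.+1, so the stacked matrix is square; the root
   is the first vertex ord0. *)
Definition rooted_incidence (R : realType) (m : nat) (e : digraph m m.+1) :
    'M[R]_m.+1 :=
  col_mx (delta_mx 0 ord0 : 'rV[R]_m.+1) (incidence e R).

Definition path_matrix (R : realType) (m : nat) (e : digraph m m.+1) :
    'M[R]_m.+1 :=
  invmx (rooted_incidence R e).

Section Norms.
Variables (R : realType) (n : nat).
Implicit Type v : 'cV[R]_n.

Definition l1norm v : R := \sum_i `|v i 0|.
Definition l2norm v : R := Num.sqrt (\sum_i v i 0 ^+ 2).
Definition sqnormn v : R := l2norm v ^+ 2 / n%:R.

End Norms.

Definition argmin (R : realType) (T : Type) (F : T -> R) : set T :=
  [set x | forall y, F x <= F y].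

(* Main.v *)
Require Import Defs.
From mathcomp Require Import all_boot all_order all_algebra.
From mathcomp Require Import boolp classical_sets reals.
From mathcomp Require Import set_interval topology normedtype derive.
From mathcomp Require Import ring lra.
Import Order.TTheory GRing.Theory Num.Theory.
Import numFieldNormedType.Exports.
Local Open Scope ring_scope.
Local Open Scope classical_set_scope.

(** Row [i] of [D *m f] is the difference of [f] along the edge [e_i], so the
    kernel of the incidence matrix of a connected graph consists of the constant
    vectors, and prepending the row that reads [f] at the root leaves only the
    zero vector ([incidence_kernel_const], [rooted_incidence_unitmx]). The
    stacked matrix is square because a tree on [m.+1] vertices has [m] edges;
    hence it is invertible.

    Since [X] is the inverse of the stacked matrix, the lower block of the
    identity says that [D *m (X *m b)] is [b] without its first entry
    ([incidence_path_matrix]). The two objectives are therefore related by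
    [G = F \o mulmx X], and as [mulmx X] is a bijection it carries the
    minimizers of [G] onto those of [F] ([argmin_reparam]).

    That the minimizer of [F] exists and is unique concerns generalized lasso
    problems with an arbitrary penalty matrix. The quadratic loss bounds every
    coordinate of a vector in a given sublevel set, so the continuous objective
    can be minimized over a compact box ([generalized_lasso_argmin_exists]).
    Two minimizers [f] and [g] must coincide because the objective at their
    midpoint is lower than their average by at least [sqnormn (f - g) / 4]
    ([generalized_lasso_argmin_unique]). *)

Section RootedIncidence.
Variables (R : realType) (m : nat).

Lemma incidence_mulmx_eq0 (n : nat) (e : digraph m n) (f : 'cV[R]_n)
    (i : 'I_m) :
  (incidence e R *m f) i 0 = 0 -> f (e i).1 0 = f (e i).2 0.
Proof.
(* A self-loop has the row -1 at its vertex, not 0, so it is a separate case. *)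
have [->//|e12] := eqVneq (e i).1 (e i).2.
rewrite mxE (bigD1 (e i).1)//= (bigD1 (e i).2) ?(eq_sym (e i).2)//=.
rewrite big1 => [|j /andP[/negPf j1 /negPf j2]].
  by rewrite !mxE !eqxx eq_sym (negPf e12); lra.
by rewrite mxE j1 j2 mul0r.
Qed.

(** Each step of a walk between two vertices follows an edge, forwards or
    backwards, along which [f] does not change. *)
Lemma incidence_kernel_const (n : nat) (e : digraph m n) (f : 'cV[R]_n) :
  graph_connected e -> incidence e R *m f = 0 -> forall x y, f x 0 = f y 0.
Proof.
move=> econn Df0 x y.
have adj u v : undirected_adj e u v -> f u 0 = f v 0.
  move=> /existsP[i].
  have := @incidence_mulmx_eq0 _ e f i; rewrite Df0 mxE => /(_ erefl) fi.
  by case/orP => /eqP ei; move: fi; rewrite ei /= => ->.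
have /connectP[p + ->] := econn x y.
elim: p x => //= z p IHp x /andP[/adj -> ]; exact: IHp.
Qed.

Lemma rooted_incidence_unitmx (e : digraph m m.+1) :
  graph_connected e -> rooted_incidence R e \in unitmx.
Proof.
move=> econn; rewrite unitmxE unitfE -det_tr; apply/negP => /det0P[v v0].
move=> /(congr1 trmx); rewrite trmx_mul trmxK trmx0 => Mv0.
have : col_mx (delta_mx 0 ord0 : 'rV[R]_m.+1) (incidence e R) *m v^T =
    col_mx 0 0 by rewrite col_mx0; exact: Mv0.
rewrite mul_col_mx => /eq_col_mx[v00 Dv0].
have vroot : v 0 ord0 = 0.
  by move/matrixP: v00 => /(_ 0 0); rewrite -rowE !mxE.
case/eqP: v0; apply/rowP => j; rewrite [RHS]mxE -vroot.
by have := incidence_kernel_const _ _ _ econn Dv0 j ord0; rewrite !mxE.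
Qed.

(** Reparametrizing by the path matrix turns the total-variation penalty of the
    graph into an ordinary lasso penalty that spares the root coefficient. *)
Lemma incidence_path_matrix (e : digraph m m.+1) (b : 'cV[R]_m.+1) :
  graph_connected e ->
  incidence e R *m (path_matrix R e *m b) = row' ord0 b.
Proof.
move=> econn.
set f := path_matrix R e *m b.
have : col_mx (delta_mx 0 ord0 : 'rV[R]_m.+1) (incidence e R) *m f = b.
  rewrite -[LHS]/(rooted_incidence R e *m f) /f mulmxA /path_matrix.
  by rewrite mulmxV ?mul1mx ?rooted_incidence_unitmx.
rewrite mul_col_mx => Mb.
apply/colP => i; rewrite [RHS]mxE -[in RHS]Mb -rshift1.
by rewrite -[RHS]/(col_mx _ _ (rshift 1 i) 0) col_mxEd.
Qed.

End RootedIncidence.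

Section Norms.
Variables (R : realType).

Lemma sqnormnE n (v : 'cV[R]_n) : sqnormn v = (\sum_i v i 0 ^+ 2) / n%:R.
Proof.
by rewrite /sqnormn /l2norm sqr_sqrtr// sumr_ge0// => i _; exact: sqr_ge0.
Qed.

Lemma sqnormn_gt0 n (v : 'cV[R]_n) : v != 0 -> 0 < sqnormn v.
Proof.
case: n v => [v|n v]; first by rewrite [v]flatmx0 eqxx.
move=> v0; rewrite sqnormnE divr_gt0 ?ltr0n// lt_neqAle.
rewrite sumr_ge0 ?andbT; last by move=> i _; exact: sqr_ge0.
apply: contraNN v0; rewrite eq_sym psumr_eq0 => [/allP v0|i _]; last first.
  exact: sqr_ge0.
apply/eqP/colP => i; rewrite mxE.
by have := v0 i; rewrite mem_index_enum sqrf_eq0 => /(_ isT)/eqP.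
Qed.

(** The parallelogram identity for [Y - f] and [Y - g], arranged to display the
    strong convexity of the quadratic loss. *)
Lemma sqnormn_midpoint n (Y f g : 'cV[R]_n) :
  sqnormn (Y - 2^-1 *: (f + g)) =
  (sqnormn (Y - f) + sqnormn (Y - g)) / 2 - sqnormn (f - g) / 4.
Proof.
rewrite !sqnormnE -mulrDl -!(mulrAC _ _ (n%:R^-1)) -mulrBl; congr (_ * _).
rewrite -big_split !mulr_suml -sumrB; apply: eq_bigr => i _ /=.
by rewrite !mxE; field.
Qed.

Lemma l1norm_ge0 n (v : 'cV[R]_n) : 0 <= l1norm v.
Proof. by apply: sumr_ge0 => i _; exact: normr_ge0. Qed.

Lemma l1norm_midpoint n (u v : 'cV[R]_n) :
  l1norm (2^-1 *: (u + v)) <= (l1norm u + l1norm v) / 2.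
Proof.
rewrite /l1norm -big_split mulr_suml; apply: ler_sum => i _ /=.
rewrite !mxE normrM ger0_norm ?invr_ge0// mulrC.
by rewrite ler_pM2r ?invr_gt0// ler_normD.
Qed.

End Norms.

Lemma continuous_sum (R : realType) (T : topologicalType) (I : Type)
    (r : seq I) (P : pred I) (F : I -> T -> R) :
  (forall i, P i -> continuous (F i)) ->
  continuous (fun x => \sum_(i <- r | P i) F i x).
Proof. by move=> Fc; apply: continuous_big => //; exact: add_continuous. Qed.

(** The box contains the sublevel set of [0], so the minimum over the
    box is at most [H 0], and hence at most every value outside the box. *)
Lemma sublevel_box_argmin (R : realType) n (H : 'rV[R]_n -> R) (K : R) :
  continuous H ->
  (forall v, H v <= H 0 -> forall i, `|v 0 i| <= K) ->
  exists v, forall w, H v <= H w.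
Proof.
move=> Hc HK.
pose B := [set v : 'rV[R]_n | forall i, `[- K, K] (v ord0 i)].
have B0 : B 0.
  by move=> i; rewrite /= in_itv/= -ler_norml; apply: HK.
have Bcompact : compact B.
  apply: (@rV_compact _ _ (fun=> `[- K, K])) => _.
  exact: segment_compact.
have Bn0 : B !=set0 by exists 0.
have [|v vB vmin] := compact_EVT_min Bn0 Bcompact (f := H).
  exact: continuous_subspaceT.
exists v => w; have [wH0|/ltW H0w] := leP (H w) (H 0).
  apply: vmin; rewrite inE => i; rewrite /= in_itv/= -ler_norml; exact: HK.
by apply: le_trans H0w; apply: vmin; rewrite inE.
Qed.

Section GeneralizedLasso.
Variables (R : realType) (k n : nat) (Y : 'cV[R]_n) (D : 'M[R]_(k, n)) (mu : R).

Definition generalized_lasso (f : 'cV[R]_n) : R :=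
  sqnormn (Y - f) + mu * l1norm (D *m f).

Local Notation F := generalized_lasso.

Lemma generalized_lasso_argmin_exists : 0 <= mu -> exists f, argmin F f.
Proof.
move=> mu_ge0.
(* Coercivity, coordinate by coordinate: |f i| <= |Y i| + a for a = |Y i - f i|,
   where a <= 1 + a ^ 2 and a ^ 2 is one of the squares adding up to n times
   the loss. *)
have coord_le (i : 'I_n) (f : 'cV[R]_n) :
    `|f i 0| <= 1 + n%:R * F f + \sum_j `|Y j 0|.
  have n0 : 0 < n%:R :> R by rewrite ltr0n (leq_ltn_trans _ (ltn_ord i)).
  have YfF : (Y i 0 - f i 0) ^+ 2 <= n%:R * F f.
    rewrite /generalized_lasso mulrDr sqnormnE mulrCA divff ?gt_eqF// mulr1.
    apply: ler_wpDr; first by rewrite !mulr_ge0 ?l1norm_ge0// ltW.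
    rewrite (bigD1 i)//= !mxE lerDl sumr_ge0// => j _; exact: sqr_ge0.
  have YY : `|Y i 0| <= \sum_j `|Y j 0|.
    by rewrite (bigD1 i)//= lerDl sumr_ge0.
  have : `|f i 0| <= `|Y i 0| + `|Y i 0 - f i 0|.
    by rewrite -{1}(subKr (Y i 0) (f i 0)) ler_normB.
  have := sqr_ge0 (`|Y i 0 - f i 0| - 1).
  have := normr_ge0 (Y i 0 - f i 0).
  move: YfF; rewrite -(real_normK (num_real (Y i 0 - f i 0))).
  set a := `|Y i 0 - f i 0|; nra.
have Fc : continuous (fun v : 'rV[R]_n => F v^T).
  rewrite (_ : (fun v => _) = fun v : 'rV[R]_n =>
      (\sum_i (Y i 0 - v 0 i) ^+ 2) * n%:R^-1 +
      mu * \sum_i `|\sum_j D i j * v 0 j|); last first.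
    apply/funext => v; rewrite /generalized_lasso sqnormnE /l1norm.
    congr (_ / _ + _ * _); apply: eq_bigr => i _; rewrite !mxE//.
    by congr `|_|; apply: eq_bigr => j _; rewrite mxE.
  have lossc : continuous (fun v : 'rV[R]_n => \sum_i (Y i 0 - v 0 i) ^+ 2).
    apply: continuous_sum => i _ v.
    have residualc : Y i 0 - w 0 i @[w --> v] --> Y i 0 - v 0 i.
      by apply: cvgB; [exact: cvg_cst|exact: coord_continuous].
    exact: (cvgM residualc residualc).
  have penaltyc :
      continuous (fun v : 'rV[R]_n => \sum_i `|\sum_j D i j * v 0 j|).
    apply: continuous_sum => i _ v.
    apply: (@continuous_comp _ _ _ (fun v : 'rV[R]_n => \sum_j D i j * v 0 j)
      Num.norm); last exact: norm_continuous.
    apply: continuous_sum => j _ {}v.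
    exact: (cvgM (cvg_cst (D i j)) (@coord_continuous R _ _ 0 j v)).
  move=> v; exact: cvgD (cvgM (lossc v) (cvg_cst _))
                        (cvgM (cvg_cst _) (penaltyc v)).
have [|v vmin] := sublevel_box_argmin _ _ _
  (1 + n%:R * F 0 + \sum_j `|Y j 0|) Fc.
  move=> w; rewrite trmx0 => wF i.
  have := coord_le i w^T; rewrite mxE => /le_trans; apply.
  by rewrite lerD2r lerD2l ler_wpM2l.
by exists v^T => g; have := vmin g^T; rewrite trmxK.
Qed.

Lemma generalized_lasso_argmin_unique f g :
  0 <= mu -> argmin F f -> argmin F g -> f = g.
Proof.
move=> mu_ge0 fmin gmin; apply/eqP; rewrite -subr_eq0.
apply: contraT => /sqnormn_gt0 fg_gt0.
have /(ler_wpM2l mu_ge0) := l1norm_midpoint R k (D *m f) (D *m g).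
rewrite -mulmxDr scalemxAr.
have := fmin g; have := gmin f; have := fmin (2^-1 *: (f + g)).
rewrite /generalized_lasso sqnormn_midpoint; lra.
Qed.

End GeneralizedLasso.

Lemma argmin_reparam (R : realType) (T U : Type) (F : T -> R) (h : U -> T)
    (k : T -> U) :
  cancel k h -> argmin F = [set h u | u in argmin (F \o h)].
Proof.
move=> kK; apply/seteqP; split=> [x xmin|_ [u umin <-] y].
  by exists (k x) => // u /=; rewrite kK.
by have := umin (k y); rewrite /= kK.
Qed.

Theorem corollary5p2 (R : realType) (m : nat) (e : digraph m m.+1)
    (etree : tree_graph e) (Y : 'cV[R]_m.+1) (lambda : R)
    (lambda_gt0 : 0 < lambda) :
  let D : 'M[R]_(m, m.+1) := incidence e R in
  let X : 'M[R]_m.+1 := path_matrix R e in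
  let F (f : 'cV[R]_m.+1) : R :=
    sqnormn (Y - f) + 2 * lambda * l1norm (D *m f) in
  let G (b : 'cV[R]_m.+1) : R :=
    sqnormn (Y - X *m b) + 2 * lambda * l1norm (row' ord0 b) in
  [/\ rooted_incidence R e \in unitmx,
      exists fA : 'cV[R]_m.+1, argmin F = [set fA]
    & argmin F = [set X *m b | b in argmin G]].
Proof.
move=> D X F G; have [econn _] := etree.
have Munit := rooted_incidence_unitmx R m e econn.
have mu_ge0 : 0 <= 2 * lambda by rewrite mulr_ge0// ltW.
split=> //.
- have [fA fAmin] := generalized_lasso_argmin_exists _ _ _ Y D _ mu_ge0.
  exists fA; apply/seteqP; split=> [g gmin|_ ->//].
  exact: (generalized_lasso_argmin_unique _ _ _ _ _ _ _ _ mu_ge0 gmin fAmin).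
- have -> : G = F \o mulmx X.
    by apply/funext => b; rewrite /G /F /= incidence_path_matrix.
  apply: (argmin_reparam _ _ _ _ _ (mulmx (rooted_incidence R e))) => f.
  by rewrite mulmxA mulVmx ?mul1mx.
Qed.
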